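(* Let $G$ be a linear group over a field of positive characteristic, let $g\in G$ be an element of infinite order, and let $C_G(g)$ be the centraliser of $g$ in $G$. Then the image of $g$ in the abelianisation of $C_G(g)$ also has infinite order.
   Context: A group $G$ is linear over a field $\mathbb{F}$ if it embeds in $GL(d,\mathbb{F})$ for some $d\in\mathbb{N}$. The abelianisation of a group $H$ is the quotient $H/[H,H]$ by its commutator subgroup. *)

(* Defs.v *)
From HB Require Import structures.
From mathcomp Require Import all_boot all_algebra.
From mathcomp Require Import boolp classical_sets.

Set Implicit Arguments.
Unset Strict Implicit.
Unset Printing Implicit Defensive.

Local Open Scope group_scope.

(* A groupType may be infinite, unlike a finGroupType. *)
Definition infinite_order (G : groupType) (x : G) : Prop :=
  forall n : nat, (0 < n)%N -> x ^+ n <> 1.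

Section GeneralLinear.
Variables (F : fieldType) (d : nat).

(* matrix.v's {'GL_n[F]} requires a finite F and identifies n = 0 with n = 1. *)
Record GL := MkGL { GL_mx :> 'M[F]_d; GL_unit : GL_mx \in unitmx }.

HB.instance Definition _ := [isSub for GL_mx].
HB.instance Definition _ := [Choice of GL by <:].

Definition GL_one : GL := MkGL (unitmx1 F d).

Definition GL_inv (A : GL) : GL :=
  @MkGL (invmx A) (etrans (unitmx_inv A) (GL_unit A)).

Fact GL_mul_subproof (A B : GL) : (A *m B)%R \in unitmx.
Proof. by rewrite unitmx_mul !GL_unit. Qed.

Definition GL_mul (A B : GL) : GL := MkGL (GL_mul_subproof A B).

Fact GL_mulA : associative GL_mul.
Proof. by move=> A B C; apply/val_inj/mulmxA. Qed.
Fact GL_mul1g : left_id GL_one GL_mul.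
Proof. by move=> A; apply/val_inj/mul1mx. Qed.
Fact GL_mulg1 : right_id GL_one GL_mul.
Proof. by move=> A; apply/val_inj/mulmx1. Qed.
Fact GL_mulVg : left_inverse GL_one GL_inv GL_mul.
Proof. by move=> A; apply/val_inj/mulVmx/GL_unit. Qed.
Fact GL_mulgV : right_inverse GL_one GL_inv GL_mul.
Proof. by move=> A; apply/val_inj/mulmxV/GL_unit. Qed.

HB.instance Definition _ :=
  isGroup.Build GL GL_mulA GL_mul1g GL_mulg1 GL_mulVg GL_mulgV.
End GeneralLinear.

Definition linear_over (F : fieldType) (G : groupType) : Prop :=
  exists (d : nat) (f : {multiplicative G -> GL F d}), injective f.

Section Centraliser.
Variables (G : groupType) (g : G).

Definition centralises : pred G := [pred h | g * h == h * g].

Record centraliser :=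
  Centraliser { cent_val :> G; centP : centralises cent_val }.

HB.instance Definition _ := [isSub for cent_val].
HB.instance Definition _ := [Choice of centraliser by <:].

Fact centralises_group_closed : group_closed centralises.
Proof.
split=> [|x y]; rewrite !inE ?mulg1 ?mul1g // => /eqP gx /eqP gy.
by apply/eqP; apply: commuteM => //; apply: commuteV.
Qed.

HB.instance Definition _ :=
  SubChoice_isSubGroup.Build G centralises centraliser
    centralises_group_closed.

Definition cent_self : centraliser := @Centraliser g (eqxx (g * g)).
End Centraliser.

Section Abelianisation.
Variable H : groupType.

Definition is_subgroup (A : set H) : Prop :=
  [/\ A 1, forall x y, A x -> A y -> A (x * y) & forall x, A x -> A x^-1].

Definition derived_subgroup : set H :=
  smallest is_subgroup [set z | exists x y : H, z = [~ x, y]].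

Fact derived1 : derived_subgroup 1.
Proof. by move=> A [[]]. Qed.

Fact derivedM x y :
  derived_subgroup x -> derived_subgroup y -> derived_subgroup (x * y).
Proof.
by move=> Dx Dy A AP; case: (AP) => [[_ AM _] _]; exact: AM (Dx A AP) (Dy A AP).
Qed.

Fact derivedV x : derived_subgroup x -> derived_subgroup x^-1.
Proof. by move=> Dx A AP; case: (AP) => [[_ _ AV] _]; exact: AV (Dx A AP). Qed.

Fact derivedR x y : derived_subgroup [~ x, y].
Proof. by move=> A [_]; apply; exists x, y. Qed.

Fact derivedJ x y : derived_subgroup x -> derived_subgroup (x ^ y).
Proof.
move=> Dx; have -> : x ^ y = x * [~ x, y] by rewrite /commg mulgA mulgV mul1g.
by apply: derivedM => //; apply: derivedR.
Qed.

Definition derived_rel (x y : H) : bool := `[< derived_subgroup (x^-1 * y) >].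

Fact derived_refl : reflexive derived_rel.
Proof. by move=> x; apply/asboolP; rewrite mulVg; apply: derived1. Qed.

Fact derived_sym : symmetric derived_rel.
Proof.
by move=> x y; apply/asboolP/asboolP => /derivedV; rewrite invgM invgK.
Qed.

Fact derived_trans : transitive derived_rel.
Proof.
move=> y x z /asboolP xy /asboolP yz; apply/asboolP.
by move: (derivedM xy yz); rewrite mulgA mulgK.
Qed.

Canonical derived_equiv :=
  EquivRel derived_rel derived_refl derived_sym derived_trans.

Definition abelianisation := {eq_quot derived_equiv}%qT.
HB.instance Definition _ := Choice.on abelianisation.

Definition to_abelianisation (x : H) : abelianisation :=
  (\pi_abelianisation x)%qT.

Fact to_abelianisationP x y :
  to_abelianisation x = to_abelianisation y <-> derived_subgroup (x^-1 * y).
Proof.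
by split=> [/eqquotP/asboolP | Dxy] //; apply/eqquotP/asboolP.
Qed.

Fact to_abelianisation_repr (a : abelianisation) :
  to_abelianisation (repr a) = a.
Proof. exact: reprK. Qed.

Definition ab_one : abelianisation := to_abelianisation 1.
Definition ab_inv (a : abelianisation) : abelianisation :=
  to_abelianisation (repr a)^-1.
Definition ab_mul (a b : abelianisation) : abelianisation :=
  to_abelianisation (repr a * repr b).

Fact to_abM x y :
  ab_mul (to_abelianisation x) (to_abelianisation y)
  = to_abelianisation (x * y).
Proof.
apply/to_abelianisationP.
have /to_abelianisationP := to_abelianisation_repr (to_abelianisation x).
have /to_abelianisationP := to_abelianisation_repr (to_abelianisation y).
set u := repr _; set v := repr _ => Duy Dvx.
have -> : (v * u)^-1 * (x * y) = (v^-1 * x) ^ u * (u^-1 * y).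
  by rewrite /conjg invgM !mulgA mulgK.
by apply: derivedM => //; apply: derivedJ.
Qed.

Fact to_abV x :
  ab_inv (to_abelianisation x) = to_abelianisation x^-1.
Proof.
apply/to_abelianisationP.
have /to_abelianisationP := to_abelianisation_repr (to_abelianisation x).
set u := repr _ => Dux.
have -> : u^-1^-1 * x^-1 = ((u^-1 * x)^-1) ^ x^-1.
  by rewrite /conjg invgM !invgK !mulgA mulgV mul1g.
by apply: derivedJ; apply: derivedV.
Qed.

Fact ab_mulA : associative ab_mul.
Proof.
move=> a b c; rewrite -[a]to_abelianisation_repr -[b]to_abelianisation_repr.
by rewrite -[c]to_abelianisation_repr !to_abM mulgA.
Qed.
Fact ab_mul1g : left_id ab_one ab_mul.
Proof. by move=> a; rewrite -[a]to_abelianisation_repr to_abM mul1g. Qed.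
Fact ab_mulg1 : right_id ab_one ab_mul.
Proof. by move=> a; rewrite -[a]to_abelianisation_repr to_abM mulg1. Qed.
Fact ab_mulVg : left_inverse ab_one ab_inv ab_mul.
Proof. by move=> a; rewrite -[a]to_abelianisation_repr to_abV to_abM mulVg. Qed.
Fact ab_mulgV : right_inverse ab_one ab_inv ab_mul.
Proof. by move=> a; rewrite -[a]to_abelianisation_repr to_abV to_abM mulgV. Qed.

HB.instance Definition _ :=
  isGroup.Build abelianisation ab_mulA ab_mul1g ab_mulg1 ab_mulVg ab_mulgV.

Fact to_abelianisation_is_multiplicative :
  {morph to_abelianisation : x y / x * y}.
Proof. by move=> x y; rewrite -to_abM. Qed.

HB.instance Definition _ :=
  isMultiplicative.Build H abelianisation to_abelianisation
    to_abelianisation_is_multiplicative.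
End Abelianisation.

(* Main.v *)
(* If g^n is a product of commutators in its centraliser C, then the
   determinant of the action of C on an eigenspace of g, for an eigenvalue z in
   any extension field, is a homomorphism from C to an abelian group; it kills
   g^n, hence z^(n r) = 1 with r the dimension of the eigenspace.  So all the
   eigenvalues of g are N-th roots of unity for N = n d!, and g^N is unipotent;
   in characteristic p a unipotent matrix has p-power order, so g would have
   finite order. *)
Require Import Defs.
From HB Require Import structures.
From mathcomp Require Import all_boot all_algebra.
From mathcomp Require Import fieldext.
From mathcomp Require Import boolp.

Import GRing.Theory.

(** Strong induction on the size: a reducible [q] has a proper divisor of smaller size. Excluded
    middle stands in for an irreducibility test over an arbitrary field. *)
Lemma irreducible_factor (F : fieldType) (q : {poly F}) :
  (1 < size q)%N -> exists2 r : {poly F}, irreducible_poly r & (r %| q)%R.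
Proof.
have [m] := ubnP (size q); elim: m q => // m IHm q le_q_m q_gt1.
have [irr_q | red_q] := pselect (irreducible_poly q).
  by exists q; rewrite ?dvdpp.
have [[r [r_neq1 r_q] r_neq_q] | max_q] :=
    pselect (exists2 r : {poly F}, size r != 1%N /\ (r %| q)%R & ~~ (r %= q)%R).
  have q_neq0 : q != 0%R by rewrite -size_poly_gt0 ltnW.
  have lt_r_q : (size r < size q)%N.
    by rewrite ltn_neqAle dvdp_leq // andbT dvdp_size_eqp.
  have r_gt1 : (1 < size r)%N.
    by rewrite ltn_neqAle eq_sym r_neq1 size_poly_gt0 (dvdpN0 r_q).
  have [s irr_s s_r] := IHm r (leq_trans lt_r_q le_q_m) r_gt1.
  by exists s => //; apply: dvdp_trans r_q.
case: red_q; split=> // r r_neq1 r_q.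
by apply/negPn/negP => r_neq_q; apply: max_q; exists r.
Qed.

(** Splitting off irreducible factors one at a time costs one copy of [h] each; [size q] bounds
    their number, with multiplicity. *)
Lemma dvdp_exp_irreducible (F : fieldType) (q h : {poly F}) :
    q != 0%R ->
    (forall r : {poly F}, irreducible_poly r -> (r %| q)%R -> (r %| h)%R) ->
  (q %| h ^+ size q)%R.
Proof.
have [m] := ubnP (size q); elim: m q => // m IHm q le_q_m q_neq0 dvd_h.
have [q_le1 | q_gt1] := leqP (size q) 1.
  apply: (@dvdp_trans _ 1%R); last exact: dvd1p.
  by rewrite dvdp1 eqn_leq q_le1 size_poly_gt0.
have [r irr_r r_q] := irreducible_factor F q q_gt1.
have [s def_q] := dvdpP _ _ r_q.
have s_neq0 : s != 0%R by apply: contraNneq q_neq0 => s0; rewrite def_q s0 mul0r.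
have r_gt1 : (1 < size r)%N by case: irr_r.
have lt_s_q : (size s < size q)%N.
  rewrite def_q size_mul // ?irredp_neq0 //.
  by rewrite -(ltn_predK r_gt1) addnS -addn1 leq_add2l -ltnS (ltn_predK r_gt1).
have s_h : (s %| h ^+ size s)%R.
  apply: IHm => // [|r' irr_r' r'_s]; first exact: leq_trans lt_s_q _.
  by apply: dvd_h => //; rewrite def_q dvdp_mulr.
apply: (@dvdp_trans _ (h ^+ (size s).+1)%R); last exact: dvdp_exp2l.
by rewrite [X in (X %| _)%R]def_q exprSr dvdp_mul // dvd_h.
Qed.

Lemma dvdp_exp_root (F : fieldType) (q h : {poly F}) :
    q != 0%R ->
    (forall (L : fieldType) (phi : {rmorphism F -> L}) (z : L),
       root (map_poly phi q) z -> root (map_poly phi h) z) ->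
  (q %| h ^+ size q)%R.
Proof.
move=> q_neq0 rootP; apply: dvdp_exp_irreducible => // r irr_r r_q.
(* Test the root hypothesis at a root of [r] in [F[X]/(r)]. If [r] did not divide [h], the two would
   be coprime, also over [L], and could not share the root [z]. *)
have [L _ [z r_z _]] := irredp_FAdjoin irr_r.
apply: contraLR r_z => r_h.
have := coprimep_map (GRing.in_alg L) r h.
rewrite (irreducible_poly_coprime _ irr_r) r_h => co_rh.
apply/negP => r_z; have /negP := coprimep_root co_rh r_z; apply; apply: rootP.
move: r_z; rewrite !root_factor_theorem => /dvdp_trans; apply.
by rewrite dvdp_map.
Qed.

Lemma expmx_pchar_eigenvalue (F : fieldType) (p : nat)
    (hp : p \in [pchar F]%R) (d N : nat) (A : 'M[F]_d.+1) :
    (forall (L : fieldType) (phi : {rmorphism F -> L}) (z : L),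
       eigenvalue (map_mx phi A) z -> z ^+ N = 1)%R ->
  exists k : nat, (A ^+ (N * p ^ k) = 1)%R.
Proof.
move=> eigP; set q := char_poly A; exists (size q).
have p_gt1 : (1 < p)%N by rewrite prime_gt1 // (pcharf_prime hp).
have q_dvd : (q %| 'X^(N * p ^ size q) - 1)%R.
  (* Frobenius in [{poly F}]. *)
  have -> : ('X^(N * p ^ size q) - 1 = ('X^N - 1) ^+ (p ^ size q) :> {poly F})%R.
    have pP : ([pchar {poly F}]%R).-nat (p ^ size q).
      by rewrite pnatX pnatE ?(pcharf_prime hp) // pchar_poly hp.
    apply/eqP; rewrite subr_eq -[X in (_ == _ + X)%R](expr1n _ (p ^ size q)).
    by rewrite -exprDn_pchar // subrK exprM.
  apply: (@dvdp_trans _ (('X^N - 1) ^+ size q)%R); last first.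
    by apply: dvdp_exp2l; rewrite ltnW // ltn_expl.
  apply: dvdp_exp_root => [|L phi z]; first exact: monic_neq0 (char_poly_monic A).
  rewrite map_char_poly -eigenvalue_root_char => /eigP zN.
  by rewrite rmorphB rmorph1 /= map_polyXn /root !hornerE zN subrr.
(* Evaluate the divisibility at [A]: Cayley-Hamilton kills the multiple of [q]. *)
have [s def_X] := dvdpP _ _ q_dvd.
have := congr1 (horner_mx A) def_X.
rewrite rmorphM /= Cayley_Hamilton mulr0 rmorphB rmorph1 rmorphXn /= horner_mx_X.
by move/eqP; rewrite subr_eq0 => /eqP.
Qed.

(** The kernel of [chi] is a subgroup containing all commutators, since [R] is commutative. A ring
    as codomain lets [chi] be a determinant directly. *)
Lemma derived_subgroup_ker (H : groupType) (R : comUnitRingType) (chi : H -> R) :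
    chi 1%g = 1%R -> {morph chi : x y / (x * y)%g >-> (x * y)%R} ->
  forall x : H, derived_subgroup x -> chi x = 1%R.
Proof.
move=> chi1 chiM x Dx; apply: (Dx (fun y => chi y = 1%R)); split.
  split=> // [y z /= y1 z1 | y /= y1]; first by rewrite chiM y1 z1 mulr1.
  by rewrite -[LHS]mulr1 -{1}y1 -chiM mulVg.
move=> _ [y [z ->]] /=; rewrite /commg /conjg !chiM.
have yV : (chi y^-1%g * chi y = 1)%R by rewrite -chiM mulVg.
have zV : (chi z^-1%g * chi z = 1)%R by rewrite -chiM mulVg.
by rewrite [X in (_ * X)%R]mulrCA zV mulr1.
Qed.

(* gmulf1 and gmulfXn ask for unitary morphisms. *)
Lemma multiplicative1 {G H : groupType} (f : {multiplicative G -> H}) :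
  f 1%g = 1%g.
Proof. by apply: (mulgI (f 1%g)); rewrite -gmulfM !mulg1. Qed.

Lemma multiplicativeX {G H : groupType} (f : {multiplicative G -> H}) (n : nat) :
  {morph f : x / (x ^+ n)%g >-> (x ^+ n)%g}.
Proof.
move=> x; elim: n => [|n IHn]; first by rewrite !expg0 multiplicative1.
by rewrite !expgS gmulfM IHn.
Qed.

Section CentraliserDet.
Variables (F L : fieldType) (d : nat) (G : groupType).
Variables (f : {multiplicative G -> GL F d}) (phi : {rmorphism F -> L}).
Variables (g : G) (z : L).

Let A := map_mx phi (f g).
Let V := row_base (eigenspace A z).

(** With [V] a basis of a stable row space, [conjmx V M] is the matrix of [M] restricted to that
    space. *)
Definition eigenspace_det (h : centraliser g) : L :=
  (\det (conjmx V (map_mx phi (f (val h)))))%R.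

Let stableV (h : centraliser g) : stablemx V (map_mx phi (f (val h))).
Proof.
rewrite stablemx_row_base comm_mx_stable_eigenspace //.
rewrite /comm_mx -!map_mxM; congr map_mx.
have /eqP := centP h => /(congr1 f); rewrite !gmulfM.
by move/(congr1 (@GL_mx F d)).
Qed.

Lemma eigenspace_det_morph :
  {morph eigenspace_det : x y / (x * y)%g >-> (x * y)%R}.
Proof.
move=> x y; rewrite /eigenspace_det -det_mulmx -conjmxM ?inE ?stableV //.
by rewrite -map_mxM gmulfM.
Qed.

(** On its eigenspace [g] acts as the scalar [z]. *)
Lemma eigenspace_det_expg (n : nat) :
  eigenspace_det (cent_self g ^+ n)%g = (z ^+ (n * \rank (eigenspace A z)))%R.
Proof.
elim: n => [|n IHn].
  have f1 : GL_mx (f (val (1%g : centraliser g))) = 1%:M%R by rewrite gmulf1 multiplicative1.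
  rewrite expg0 mul0n expr0 /eigenspace_det f1 map_mx1 /conjmx mulmx1.
  by rewrite mulmxVp ?row_base_free // det1.
rewrite expgS eigenspace_det_morph IHn mulSn exprD; congr (_ * _)%R.
rewrite /eigenspace_det (conjmx_eigenvalue (a := z)) ?row_base_free //.
  by rewrite det_scalar.
by rewrite eq_row_base.
Qed.

Lemma eigenvalue_expr_rank (n : nat) :
  derived_subgroup (cent_self g ^+ n)%g ->
  (z ^+ (n * \rank (eigenspace A z)) = 1)%R.
Proof.
rewrite -eigenspace_det_expg; apply: derived_subgroup_ker.
  by rewrite -(expg0 (cent_self g)) eigenspace_det_expg mul0n.
exact: eigenspace_det_morph.
Qed.

(** The rank lies between 1 and [d], so it divides [d!]; this exponent serves all eigenvalues at
    once. *)
Lemma eigenvalue_expr_fact (n : nat) :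
  derived_subgroup (cent_self g ^+ n)%g -> eigenvalue A z ->
  (z ^+ (n * d`!) = 1)%R.
Proof.
move=> Dgn z_eig.
have /dvdnP[m ->] : \rank (eigenspace A z) %| d`!.
  by rewrite dvdn_fact // rank_leq_row andbT lt0n mxrank_eq0.
by rewrite mulnCA mulnC exprM eigenvalue_expr_rank // expr1n.
Qed.
End CentraliserDet.

Theorem theorem3 (F : fieldType) (p : nat) (hp : p \in [pchar F]%R)
    (G : groupType) (hG : linear_over F G) (g : G) (hg : infinite_order g) :
  infinite_order (to_abelianisation (cent_self g)).
Proof.
move=> n n_gt0 gn1; case: hG => d [f f_inj].
have Dgn : derived_subgroup (cent_self g ^+ n)%g.
  have : to_abelianisation 1%g = to_abelianisation (cent_self g ^+ n)%g.
    by rewrite multiplicative1 multiplicativeX gn1.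
  by move/to_abelianisationP; rewrite invg1 mul1g.
have p_gt0 : (0 < p)%N by rewrite prime_gt0 // (pcharf_prime hp).
suffices [m m_gt0 gm1] : exists2 m, (0 < m)%N & GL_mx (f (g ^+ m)%g) = 1%:M%R.
  by apply: (hg m m_gt0); apply/f_inj/val_inj; rewrite multiplicative1.
(* In dimension 0 all matrices are equal; [expmx_pchar_eigenvalue] needs positive size, where square
   matrices form a nontrivial ring. *)
case: d f f_inj => [|d] f f_inj.
  by exists 1%N => //; rewrite [LHS]flatmx0 [RHS]flatmx0.
have [|k Ak1] := @expmx_pchar_eigenvalue F p hp d (n * d.+1`!) (f g).
  by move=> L phi z; apply: eigenvalue_expr_fact.
exists (n * d.+1`! * p ^ k)%N.
  by rewrite !muln_gt0 n_gt0 fact_gt0 expn_gt0 p_gt0.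
(* The induction matches powers in the group [GL] with powers in the matrix ring. *)
rewrite -[RHS]Ak1 multiplicativeX; elim: (n * _ * _)%N => [|m IHm] //.
by rewrite expgS exprS -IHm.
Qed.
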